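(* As $n \to \infty$, $$\left(\tfrac12 - o(1)\right)\frac{n^2}{\lg n} \;\le\; \operatorname{bc}(n) \;\le\; \operatorname{bp}(n) \;\le\; \left(\tfrac12 + o(1)\right)\frac{n^2}{\lg n}.$$
   Context: All graphs are finite, simple and undirected; $\lg$ is the base-2 logarithm. A biclique of a graph $G$ is a (not necessarily induced) complete bipartite subgraph of $G$. A biclique covering of $G$ is a family $\{B_1,\dots,B_k\}$ of bicliques of $G$ with $E(G)=\bigcup_i E(B_i)$; it is a biclique partition if the edge sets $E(B_i)$ are pairwise disjoint. The weight of such a family is $\sum_{i=1}^k |V(B_i)|$. Let $\operatorname{bc}(G)$ (respectively $\operatorname{bp}(G)$) be the minimum weight of a biclique covering (respectively biclique partition) of $G$, and let $\operatorname{bc}(n)$ (respectively $\operatorname{bp}(n)$) be the maximum of $\operatorname{bc}(G)$ (respectively $\operatorname{bp}(G)$) over all graphs $G$ on $n$ vertices. *)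

(* Defs.v *)
From HB Require Import structures.
From mathcomp Require Import all_boot all_order all_algebra.
From mathcomp Require Import reals exp.

Set Implicit Arguments.
Unset Strict Implicit.
Unset Printing Implicit Defensive.

Import Order.TTheory GRing.Theory Num.Theory.

(* A finite simple graph on T is its set of edges, an edge being a
   two-element subset of T. *)
Record sgraph (T : finType) := SGraph {
  edges : {set {set T}};
  _ : [forall e in edges, #|e| == 2]
}.

HB.instance Definition _ (T : finType) := [isSub for @edges T].
HB.instance Definition _ (T : finType) := [Finite of sgraph T by <:].

Section Bicliques.

Variable T : finType.
Implicit Types (G : sgraph T) (B : {set T} * {set T}).
Implicit Types (F : {set {set T} * {set T}}).

(* A complete bipartite graph is given by the ordered pair of its sides. The
   pairs (X, Y) and (Y, X) encode the same subgraph; a biclique partition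
   cannot contain both, and listing both in a covering only adds weight. *)
Definition biclique_vertices B : {set T} := B.1 :|: B.2.

Definition biclique_edges B : {set {set T}} :=
  [set [set x; y] | x in B.1, y in B.2].

Definition is_biclique G B : bool :=
  [&& B.1 != set0, B.2 != set0, [disjoint B.1 & B.2]
    & biclique_edges B \subset edges G].

Definition biclique_covering G F : bool :=
  [forall B in F, is_biclique G B]
  && (edges G == \bigcup_(B in F) biclique_edges B).

Definition biclique_partition G F : bool :=
  biclique_covering G F
  && [forall B in F, forall C in F,
        (B != C) ==> [disjoint biclique_edges B & biclique_edges C]].

Definition weight F : nat := \sum_(B in F) #|biclique_vertices B|.

(* The partition of a graph into its single edges shows that the minima
   below range over nonempty sets. *)
Lemma ex_partition_weight G :
  exists w, [exists F, biclique_partition G F && (weight F == w)].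
Proof.
case: G => E hE; set G := SGraph hE.
have hE2 e : e \in E -> exists x y, x != y /\ e = [set x; y].
  move=> eE; have /cards2P[x [y [xy ->]]] := forall_inP hE e eE.
  by exists x, y.
pose s (e : {set T}) : {set T} :=
  if [pick x in e] is Some x then [set x] else set0.
pose b e := (s e, e :\: s e).
have bP e : e \in E ->
    exists x y, [/\ x != y, e = [set x; y] & b e = ([set x], [set y])].
  move=> /hE2[x [y [xy eE]]]; rewrite /b /s; case: pickP => [z|/(_ x)]; last first.
    by rewrite eE !inE eqxx.
  rewrite {1}eE !inE => /orP[]/eqP->; [exists x, y|exists y, x]; split => //.
  - congr pair; apply/setP=> t; rewrite eE !inE.
    by case: (eqVneq t x) => //= ->; rewrite (negPf xy).
  - by rewrite eq_sym.
  - by rewrite eE setUC.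
  - congr pair; apply/setP=> t; rewrite eE !inE.
    by case: (eqVneq t y) => //= [->|_]; rewrite ?orbF // eq_sym (negPf xy).
have beE e : e \in E -> biclique_edges (b e) = [set e].
  move=> /bP[x [y [_ eE ->]]]; rewrite /biclique_edges /= eE.
  apply/setP=> f; rewrite inE; apply/imset2P/eqP => [[u v /set1P-> /set1P->]//|->].
  by exists x y; rewrite ?set11.
pose F := [set b e | e in E].
exists (weight F); apply/existsP; exists F; rewrite eqxx andbT.
apply/andP; split; [apply/andP; split|].
- apply/forall_inP => _ /imsetP[e eE ->].
  rewrite /is_biclique beE // sub1set eE andbT.
  case/bP: (eE) => x [y [xy _ ->]] /=.
  rewrite -!card_gt0 !cards1 /=.
  by rewrite disjoints1 inE.
- apply/eqP/setP=> e; apply/idP/bigcupP => [eE|[_ /imsetP[f fE ->]]].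
    by exists (b e); [exact: imset_f|rewrite beE // set11].
  by rewrite beE // => /set1P->.
- apply/forall_inP => _ /imsetP[e eE ->].
  apply/forall_inP => _ /imsetP[f fE ->]; apply/implyP => bef.
  rewrite !beE // disjoints1 inE.
  by apply: contraNneq bef => ->.
Qed.

Lemma ex_covering_weight G :
  exists w, [exists F, biclique_covering G F && (weight F == w)].
Proof.
have [w /existsP[F /andP[/andP[cF _] wF]]] := ex_partition_weight G.
by exists w; apply/existsP; exists F; rewrite cF.
Qed.

Definition bc G : nat := ex_minn (ex_covering_weight G).
Definition bp G : nat := ex_minn (ex_partition_weight G).

End Bicliques.

Definition bc_max (n : nat) : nat := \max_(G : sgraph 'I_n) bc G.
Definition bp_max (n : nat) : nat := \max_(G : sgraph 'I_n) bp G.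

Definition lg (R : realType) (x : R) : R := (ln x / ln 2)%R.

(* Main.v *)
Require Import Defs.
From mathcomp Require Import all_boot all_order all_algebra.
From mathcomp Require Import zify ring lra.

(** Both bounds are elementary.

    Lower bound. List a biclique covering as a word: for each biclique, the
    vertices of its left side and then those of its right side, every letter
    being a vertex together with the side it belongs to. The graph can be read
    back from the word ([decode_words]), because a left letter following a
    right letter announces a new biclique, so no separators are needed. The
    word is as long as the covering is heavy and there are 2n letters, hence
    2^(n choose 2) <= (2n)^bc(n) ([bc_max_lower]). Taking logarithms,
    bc(n) >= (n^2 - n) / (2 (1 + lg n)).

    Upper bound. Cut the vertices 0, ..., n-1 into blocks of k consecutive
    ones. For a block V and a subset X of V, the vertices y of later blocks
    whose neighbourhood in V is exactly X form a biclique with X; these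
    bicliques partition the edges between different blocks. On their right
    sides a vertex y is counted once per earlier block, at most n^2 / (2k) in
    total, and the left sides have total size at most n 2^k. The edges inside
    blocks are partitioned into stars of total weight at most k n. So
    bp(n) <= n^2 / (2k) + 2 n 2^k ([bp_max_upper]). With t the integer part of
    lg n, the choice k = t - O(sqrt t), where the correction exceeds 2 lg t,
    makes the first term n^2 / (2 lg n) up to a factor 1 + O(1 / sqrt t) and
    the second one at most 2 n^2 / t^2.

    In both bounds the relative error is O(1 / sqrt t), which is the rate used
    to exhibit the two null sequences. *)

Set Implicit Arguments.
Unset Strict Implicit.
Unset Printing Implicit Defensive.

Local Open Scope nat_scope.

(** * Minimal coverings and partitions *)

Section Minima.
Variable T : finType.
Implicit Types (G : sgraph T) (F : {set {set T} * {set T}}).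

Lemma bc_witness G : exists2 F, biclique_covering G F & weight F = bc G.
Proof.
rewrite /bc; case: ex_minnP => w /existsP[F /andP[cF /eqP wF]] _.
by exists F.
Qed.

Lemma bp_witness G : exists2 F, biclique_partition G F & weight F = bp G.
Proof.
rewrite /bp; case: ex_minnP => w /existsP[F /andP[cF /eqP wF]] _.
by exists F.
Qed.

Lemma bc_min G F : biclique_covering G F -> bc G <= weight F.
Proof.
move=> cF; rewrite /bc; case: ex_minnP => w _; apply.
by apply/existsP; exists F; rewrite cF /=.
Qed.

Lemma bp_min G F : biclique_partition G F -> bp G <= weight F.
Proof.
move=> cF; rewrite /bp; case: ex_minnP => w _; apply.
by apply/existsP; exists F; rewrite cF /=.
Qed.

Lemma bc_le_bp G : bc G <= bp G.
Proof. by have [F /andP[cF _] <-] := bp_witness G; exact: bc_min. Qed.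

End Minima.

Lemma bc_max_le_bp_max n : bc_max n <= bp_max n.
Proof.
apply/bigmax_leqP => G _.
exact: leq_trans (bc_le_bp G) (@leq_bigmax (sgraph 'I_n) (@bp 'I_n) G).
Qed.

(** * Coverings as words *)

Section Words.
Variable T : finType.
Implicit Types (A X Y : {set T}) (E : {set {set T}}) (s : seq T).
Implicit Types (B : {set T} * {set T}).

(** The state holds the current left side, whether a right letter has been
    read since it began, and the edges found so far. *)
Definition read (st : {set T} * bool * {set {set T}}) (a : T * bool) :=
  let: (A, closed, E) := st in let: (x, on_left) := a in
  if on_left then (if closed then [set x] else x |: A, false, E)
  else (A, true, E :|: biclique_edges (A, [set x])).

Definition decode (w : seq (T * bool)) : {set {set T}} :=
  (foldl read (set0, true, set0) w).2.

Definition word B : seq (T * bool) :=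
  [seq (x, true) | x <- enum B.1] ++ [seq (y, false) | y <- enum B.2].

Lemma biclique_edgesUr X Y1 Y2 :
  biclique_edges (X, Y1 :|: Y2) =
  biclique_edges (X, Y1) :|: biclique_edges (X, Y2).
Proof. exact: imset2Ur. Qed.

Lemma biclique_edges0r X : biclique_edges (X, set0) = set0.
Proof. by rewrite /biclique_edges curry_imset2r big_set0. Qed.

Lemma read_left s A E :
  foldl read (A, false, E) [seq (x, true) | x <- s] =
  ([set x in s] :|: A, false, E).
Proof.
elim: s A => [|x s IH] A /=; first by rewrite set_nil set0U.
by rewrite IH set_cons setUCA setUA.
Qed.

Lemma read_right s A c E :
  foldl read (A, c, E) [seq (y, false) | y <- s] =
  (A, c || (s != [::]), E :|: biclique_edges (A, [set y in s])).
Proof.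
elim: s c E => [|y s IH] c E /=.
  by rewrite orbF set_nil biclique_edges0r setU0.
by rewrite IH orbT set_cons biclique_edgesUr setUA.
Qed.

Lemma enum_nilE X : (enum X == [::]) = (X == set0).
Proof. by rewrite -size_eq0 -cardE cards_eq0. Qed.

(** The flag is up both before and after the word of a biclique, so the left
    side of the preceding biclique is forgotten and words can be chained. *)
Lemma read_word B A E : B.1 != set0 -> B.2 != set0 ->
  foldl read (A, true, E) (word B) = (B.1, true, E :|: biclique_edges B).
Proof.
case: B => X Y /= X0 Y0; rewrite foldl_cat.
have -> : foldl read (A, true, E) [seq (x, true) | x <- enum X] = (X, false, E).
  move: (set_enum X) X0; rewrite -enum_nilE.
  case: (enum X) => // x s <- _ /=.
  by rewrite read_left set_cons setUC.
by rewrite read_right set_enum enum_nilE Y0.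
Qed.

Lemma decode_words (r : seq ({set T} * {set T})) :
  (forall B, B \in r -> (B.1 != set0) && (B.2 != set0)) ->
  decode (flatten (map word r)) = \bigcup_(B <- r) biclique_edges B.
Proof.
move=> hr; suff gen A E : (foldl read (A, true, E) (flatten (map word r))).2 =
    E :|: \bigcup_(B <- r) biclique_edges B by rewrite /decode gen set0U.
elim: r A E hr => [|B r IH] A E hr /=; first by rewrite big_nil setU0.
have /andP[B1 B2] := hr B (mem_head _ _).
rewrite foldl_cat read_word // IH; first by rewrite big_cons setUA.
by move=> C Cr; apply: hr; rewrite inE Cr orbT.
Qed.

(** Left letters produce no edge until a right letter arrives, which lets all
    words be brought to the same length. *)
Lemma decode_pad w m x : decode (w ++ nseq m (x, true)) = decode w.
Proof.
rewrite /decode foldl_cat.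
case: (foldl _ _ w) => [[A c] E] /=.
by elim: m A c => //= m IH A c.
Qed.

Lemma size_word B : [disjoint B.1 & B.2] -> size (word B) = #|biclique_vertices B|.
Proof.
move=> dB; rewrite size_cat !size_map -!cardE.
by apply/esym/eqP; rewrite leq_card_setU.
Qed.

Lemma graph_word (G : sgraph T) m : 0 < #|T| -> bc G <= m ->
  exists w : m.-tuple (T * bool), decode w = edges G.
Proof.
case/card_gt0P=> x _ bcm; have [F /andP[/forall_inP Fb /eqP FE] wF] := bc_witness G.
pose w := flatten (map word (enum F)).
have sw : size w = bc G.
  rewrite -wF /weight /w size_flatten /shape -map_comp sumnE big_map -big_enum /=.
  rewrite big_seq [RHS]big_seq; apply: eq_bigr => B; rewrite mem_enum => BF.
  by rewrite size_word //; case/and4P: (Fb B BF).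
have sz : size (w ++ nseq (m - bc G) (x, true)) == m.
  by rewrite size_cat size_nseq sw subnKC.
exists (Tuple sz); rewrite /= decode_pad decode_words; last first.
  by move=> B; rewrite mem_enum => /Fb /and4P[-> ->].
by rewrite FE big_enum.
Qed.

Lemma card_sgraph : #|{: sgraph T}| = 2 ^ 'C(#|T|, 2).
Proof.
rewrite card_sub -(card_draws T 2) -card_powerset; apply: eq_card => E.
rewrite inE powersetE; apply/forall_inP/subsetP => h e /h; by rewrite inE.
Qed.

Lemma sgraph_count m : 0 < #|T| -> (forall G : sgraph T, bc G <= m) ->
  2 ^ 'C(#|T|, 2) <= (2 * #|T|) ^ m.
Proof.
move=> T0 bcm; rewrite -card_sgraph.
have -> : 2 * #|T| = #|{: T * bool}| by rewrite card_prod card_bool mulnC.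
rewrite -card_tuple.
apply: leq_trans (leq_imset_card (fun w : m.-tuple (T * bool) => decode w) _).
rewrite -(card_imset _ val_inj); apply/subset_leq_card/subsetP => _ /imsetP[G _ ->].
have [w wG] := graph_word T0 (bcm G).
by apply/imsetP; exists w.
Qed.

End Words.

Lemma bc_max_lower n : 0 < n -> 2 ^ 'C(n, 2) <= (2 * n) ^ bc_max n.
Proof.
move=> n0; have := @sgraph_count 'I_n (bc_max n); rewrite card_ord; apply=> // G.
exact: (@leq_bigmax (sgraph 'I_n) (@bc 'I_n) G).
Qed.

(** * Partitions from blocks of consecutive vertices *)

Section Upper.
Variable n : nat.
Implicit Types (x y : 'I_n) (G : sgraph 'I_n).

Lemma set2_lt_inj x y x' y' : x < y -> x' < y' ->
  [set x; y] = [set x'; y'] -> x = x' /\ y = y'.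
Proof.
move=> xy xy' /setP e; split; apply/val_inj => /=.
- by have := e x; have := e x'; rewrite !inE -!val_eqE /=; lia.
- by have := e y; have := e y'; rewrite !inE -!val_eqE /=; lia.
Qed.

Lemma edge_lt G e : e \in edges G -> exists x y, x < y /\ e = [set x; y].
Proof.
case: G => E /= /forall_inP hE /hE /cards2P[x [y [xy ->]]].
case: (ltngtP x y) => [lt|gt|/val_inj eq]; first by exists x, y.
  by exists y, x; rewrite setUC.
by rewrite eq eqxx in xy.
Qed.

(** A pairwise disjoint family indexed by a finite type bounds bp even when it
    has empty sides: pairs with an empty side carry no edge and are dropped.
    Requiring left vertices to be smaller than right ones means that an edge
    can be covered in only one direction, so disjointness can be stated on
    ordered pairs of vertices. *)
Lemma bp_le_oriented G (I : finType) (P : pred I)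
    (b : I -> {set 'I_n} * {set 'I_n}) :
    (forall i x y, P i -> x \in (b i).1 -> y \in (b i).2 ->
       x < y /\ [set x; y] \in edges G) ->
    (forall x y, x < y -> [set x; y] \in edges G ->
       exists2 i, P i & (x \in (b i).1) && (y \in (b i).2)) ->
    (forall i j x y, P i -> P j -> x \in (b i).1 -> y \in (b i).2 ->
       x \in (b j).1 -> y \in (b j).2 -> i = j) ->
  bp G <= \sum_(i | P i) (#|(b i).1| + #|(b i).2|).
Proof.
move=> bG Gb b_inj.
pose D := [set i | P i & ((b i).1 != set0) && ((b i).2 != set0)].
pose F := [set b i | i in D].
have FP B : B \in F -> exists2 i, P i &
    [/\ B = b i, (b i).1 != set0 & (b i).2 != set0].
  by case/imsetP=> i; rewrite inE => /andP[Pi /andP[? ?]] ->; exists i.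
have F_edge B e : B \in F -> e \in biclique_edges B -> exists i x y,
    [/\ P i, B = b i, x \in (b i).1, y \in (b i).2 & e = [set x; y]].
  move=> /FP[i Pi [-> _ _]] /imset2P[x y xi yi ->].
  by exists i, x, y.
have partF : biclique_partition G F.
  apply/andP; split; [apply/andP; split|].
  - apply/forall_inP => B BF; have [i Pi [Bi i1 i2]] := FP B BF.
    rewrite /is_biclique Bi i1 i2 /=; apply/andP; split.
      rewrite -setI_eq0; apply/eqP/setP => x; rewrite !inE.
      by apply/negP => /andP[x1 x2]; have [] := bG i x x Pi x1 x2; rewrite ltnn.
    apply/subsetP => _ /imset2P[x y xi yi ->].
    by have [] := bG i x y Pi xi yi.
  - apply/eqP/setP => e; apply/idP/bigcupP => [eG|[B BF eB]].
      have [x [y [xy ee]]] := edge_lt eG; rewrite ee in eG.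
      have [i Pi /andP[xi yi]] := Gb x y xy eG.
      exists (b i); last by rewrite ee; apply/imset2P; exists x y.
      apply: imset_f; rewrite inE Pi /=.
      by apply/andP; split; apply/set0Pn; [exists x|exists y].
    have [i [x [y [Pi _ xi yi ->]]]] := F_edge _ _ BF eB.
    by have [] := bG i x y Pi xi yi.
  - apply/forall_inP => B BF; apply/forall_inP => C CF; apply/implyP.
    apply: contraR => /pred0Pn[e /andP[/= eB eC]].
    have [i [x [y [Pi -> xi yi eij]]]] := F_edge _ _ BF eB.
    have [j [x' [y' [Pj -> xj yj e']]]] := F_edge _ _ CF eC.
    have [xx yy] : x = x' /\ y = y'.
      apply: set2_lt_inj; last by rewrite -eij -e'.
        by have [] := bG i x y Pi xi yi.
      by have [] := bG j x' y' Pj xj yj.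
    by subst x' y'; rewrite (b_inj i j x y).
apply: leq_trans (bp_min partF) _.
rewrite [leqRHS](bigID (mem D)) /=; apply: leq_trans (leq_addr _ _).
rewrite [leqRHS](eq_bigl (mem D)); last by move=> i; rewrite /= inE; case: (P i).
rewrite [leqRHS](partition_big_imset b) /=; apply: leq_sum => _ /imsetP[i iD ->].
rewrite (bigD1 i) ?iD ?eqxx //=.
apply: leq_trans (leq_addr _ _); rewrite leq_card_setU //.
Qed.

Variable k : nat.
Hypothesis k0 : 0 < k.

Definition block (i : nat) : {set 'I_n} := [set x : 'I_n | x %/ k == i].

Lemma card_block i : #|block i| <= k.
Proof.
have h x : x %% k < k by rewrite ltn_mod.
rewrite -[k in _ <= k]card_ord.
apply: (@leq_card_in _ _ (fun x => Ordinal (h x))) => x y.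
rewrite !inE => /eqP xi /eqP yi [e]; apply/val_inj => /=.
by rewrite (divn_eq x k) (divn_eq y k) xi yi e.
Qed.

(** Bounds the total size of the right sides: a vertex y has y %/ k earlier
    blocks. *)
Lemma sum_divn : (\sum_(y < n) y %/ k) * (2 * k) <= n ^ 2.
Proof.
apply: (@leq_trans ((\sum_(y < n) y) * 2)).
  rewrite mulnCA mulnC leq_mul2r big_distrl /=.
  by apply: leq_sum => y _; exact: leq_trunc_div.
rewrite -(big_mkord xpredT (fun i => i)) muln2.
elim: n => [|m IH]; first by rewrite big_geq.
by rewrite big_nat_recr //= doubleD; move: IH; lia.
Qed.

Definition back_nbhd G (i : nat) y : {set 'I_n} :=
  [set x : 'I_n in block i | [set x; y] \in edges G].

(** A pair (i, X) stands for a subset X of block i; a vertex y stands for the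
    star from y to its smaller neighbours in its own block. Indices below
    n %/ k suffice, because a block i with a vertex in a later one has
    i < (n - 1) %/ k. *)
Definition pieces_index := (('I_(n %/ k) * {set 'I_n}) + 'I_n)%type.

Definition valid_piece (p : pieces_index) : bool :=
  if p is inl (i, X) then X \subset block i else true.

Definition piece G (p : pieces_index) : {set 'I_n} * {set 'I_n} :=
  match p with
  | inl (i, X) => (X, [set y : 'I_n | (i < y %/ k) & back_nbhd G i y == X])
  | inr y => ([set x in back_nbhd G (y %/ k) y | x < y], [set y])
  end.

(** For a fixed block, the right sides partition the later vertices according
    to their neighbourhood in the block. *)
Lemma cross_weight G (i : 'I_(n %/ k)) :
  \sum_(X : {set 'I_n} | X \subset block i)
     (#|(piece G (inl (i, X))).1| + #|(piece G (inl (i, X))).2|)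
  <= k * 2 ^ k + #|[set y : 'I_n | i < y %/ k]|.
Proof.
rewrite big_split /=; apply: leq_add.
  apply: (@leq_trans (\sum_(X : {set 'I_n} | X \subset block i) k)).
    apply: leq_sum => X Si.
    exact: leq_trans (subset_leq_card Si) (card_block i).
  rewrite sum_nat_const mulnC leq_mul2l.
  have -> : #|(fun X : {set 'I_n} => X \subset block i)| = 2 ^ #|block i|.
    by rewrite -card_powerset; apply: eq_card => X; rewrite powersetE.
  by rewrite leq_exp2l // card_block orbT.
rewrite -[leqRHS]sum1_card.
rewrite (partition_big (back_nbhd G i) (fun X => X \subset block i)) /=.
  apply: leq_sum => X _; rewrite -sum1_card.
  by apply/eq_leq/eq_bigl => y; rewrite !inE.
by move=> y _; apply/subsetP => x; rewrite !inE => /andP[].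
Qed.

Lemma later_count :
  \sum_(i < n %/ k) #|[set y : 'I_n | i < y %/ k]| = \sum_(y < n) y %/ k.
Proof.
rewrite (eq_bigr (fun i : 'I__ => \sum_(y < n | i < y %/ k) 1)); last first.
  by move=> i _; rewrite -sum1_card; apply: eq_bigl => y; rewrite inE.
rewrite (exchange_big_dep xpredT) //=; apply: eq_bigr => y _.
rewrite -(big_ord_widen _ (fun=> 1)); first by rewrite sum1_card card_ord.
by apply: leq_div2r; exact: ltnW.
Qed.

Lemma bp_pieces G :
  bp G <= \sum_(p | valid_piece p) (#|(piece G p).1| + #|(piece G p).2|).
Proof.
apply: bp_le_oriented => [[[i X]|y0] x y|x y xy xyG|].
- move=> Si xS; rewrite inE => /andP[iy /eqP yS].
  have := xS; rewrite -yS !inE => /andP[/eqP xi ->]; split=> //.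
  by rewrite ltnNge; apply/negP => /(leq_div2r k); rewrite xi leqNgt iy.
- by move=> _; rewrite !inE => /andP[/andP[_ e] lt] /eqP->.
- have := leq_div2r k (ltnW xy); rewrite leq_eqVlt => /orP[/eqP xy1|xy1].
    by exists (inr y); rewrite //= !inE xy1 xyG xy !eqxx.
  have lt : x %/ k < n %/ k.
    by apply: leq_trans xy1 _; apply: leq_div2r; exact: ltnW.
  exists (inl (Ordinal lt, back_nbhd G (x %/ k) y)) => /=.
    by apply/subsetP => z; rewrite !inE => /andP[].
  by rewrite !inE xyG xy1 !eqxx.
- move=> [[i X]|z] [[j X']|z'] x y /=.
  + move=> Si Sj xS; rewrite !inE => /andP[iy /eqP yS] xS' /andP[jy /eqP yS'].
    have ij : i = j.
      apply/val_inj; move/subsetP: Si => /(_ x xS).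
      by move/subsetP: Sj => /(_ x xS'); rewrite !inE => /eqP jx /eqP ix; rewrite /= -jx -ix.
    by rewrite -yS -yS' ij.
  + move=> Si _ xS; rewrite !inE => /andP[iy _] /andP[/andP[/eqP xy _] _] /eqP yz.
    move/subsetP: Si => /(_ x xS); rewrite inE xy -yz => /eqP e.
    by rewrite e ltnn in iy.
  + move=> _ Sj; rewrite !inE => /andP[/andP[/eqP xy _] _] /eqP yz xS /andP[jy _].
    move/subsetP: Sj => /(_ x xS); rewrite inE xy -yz => /eqP e.
    by rewrite e ltnn in jy.
  + by move=> _ _ _; rewrite !inE => /eqP<- _ /eqP<-.
Qed.

Lemma bp_upper G : bp G * (2 * k) <= n ^ 2 + 4 * k * n * 2 ^ k.
Proof.
apply: (@leq_trans ((\sum_(y < n) y %/ k + 2 * (n * 2 ^ k)) * (2 * k))); last first.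
  by rewrite mulnDl; apply: leq_add sum_divn _; lia.
rewrite leq_mul2r; apply/orP; right; apply: leq_trans (bp_pieces G) _.
rewrite big_sumType /= mul2n -addnn addnA; apply: leq_add.
  rewrite (_ : \sum_(p | _) _ = \sum_(i < n %/ k) \sum_(X : {set _} | X \subset block i)
      (#|(piece G (inl (i, X))).1| + #|(piece G (inl (i, X))).2|)); last first.
    by rewrite pair_big_dep; apply: eq_big => [[i X]|[i X] _].
  apply: (@leq_trans (\sum_(i < n %/ k)
      (k * 2 ^ k + #|[set y : 'I_n | i < y %/ k]|))).
    by apply: leq_sum => i _; exact: cross_weight.
  rewrite big_split /= later_count addnC leq_add2l sum_nat_const card_ord mulnA.
  by rewrite leq_mul2r leq_trunc_div orbT.
apply: (@leq_trans (\sum_(y < n) k)).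
  apply: leq_sum => y _; rewrite cards1 addn1.
  apply: leq_trans (card_block (y %/ k)); apply/proper_card/properP; split.
    by apply/subsetP => x; rewrite !inE => /andP[/andP[]].
  by exists y; rewrite !inE ?ltnn ?andbF.
by rewrite sum_nat_const card_ord leq_mul2l (ltnW (ltn_expl k _)) ?orbT.
Qed.

End Upper.

Lemma bp_max_upper n k : 0 < k ->
  bp_max n * (2 * k) <= n ^ 2 + 4 * k * n * 2 ^ k.
Proof.
move=> k0; have k2 : 0 < 2 * k by rewrite muln_gt0.
rewrite -leq_divRL //; apply/bigmax_leqP => G _.
by rewrite leq_divRL //; exact: bp_upper.
Qed.

(** * Asymptotics *)

From mathcomp Require Import all_classical all_reals all_analysis.
Import Order.TTheory GRing.Theory Num.Theory.
Import numFieldNormedType.Exports.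

Lemma sqr_succ_le_expn2 l : (l.+1 ^ 2 <= 4 * 2 ^ l)%N.
Proof.
elim: l => // -[|[|l]] // IH.
by rewrite [(2 ^ _.+3)%N]expnS; move: IH; move: (2 ^ l.+2)%N => p; lia.
Qed.

(** Takes s = 2 (l + 1) with l the integer part of lg t: then 2^s > t^2, while
    (l + 1)^2 <= 4 * 2^l keeps s below 4 sqrt t. *)
Lemma block_length t : (64 <= t)%N -> exists k s,
  [/\ (k + s = t)%N, (s ^ 2 <= 16 * t)%N & (2 ^ k * t ^ 2 <= 2 ^ t)%N].
Proof.
move=> t64; have t0 : (0 < t)%N by lia.
pose l := trunc_log 2 t; pose s := (2 * l.+1)%N.
have /andP[lt tl] : (2 ^ l <= t < 2 ^ l.+1)%N by exact: trunc_log_bounds.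
have s16 : (s ^ 2 <= 16 * t)%N.
  rewrite /s expnMn (leq_trans (leq_mul (leqnn 4) (sqr_succ_le_expn2 l))) //.
  by rewrite mulnA leq_mul2l lt orbT.
have st : (s <= t)%N.
  rewrite -leq_sqr (leq_trans s16) // -mulnn leq_mul2r (leq_trans _ t64) //.
  by rewrite orbT.
exists (t - s)%N, s; split=> //; first by rewrite subnK.
rewrite -[in leqRHS](subnK st) expnD leq_mul2l; apply/orP; right.
by rewrite /s mulnC expnM leq_sqr ltnW.
Qed.

Local Open Scope ring_scope.

Section Analysis.
Variable R : realType.

Lemma ln2_gt0 : 0 < ln 2 :> R.
Proof. by apply: ln_gt0; lra. Qed.

Lemma lgM (x y : R) : 0 < x -> 0 < y -> lg (x * y) = lg x + lg y.
Proof. by move=> x0 y0; rewrite /lg lnM ?posrE // mulrDl. Qed.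

Lemma lgXn (x : R) m : 0 < x -> lg (x ^+ m) = m%:R * lg x.
Proof. by move=> x0; rewrite /lg lnXn // -(mulr_natl (ln x)) mulrA. Qed.

Lemma lg2 : lg (2 : R) = 1.
Proof. by rewrite /lg divff // lt0r_neq0 // ln2_gt0. Qed.

Lemma ler_lg (x y : R) : 0 < x -> x <= y -> lg x <= lg y.
Proof.
move=> x0 xy; rewrite /lg ler_pM2r ?invr_gt0 ?ln2_gt0 // ler_ln ?posrE //.
exact: lt_le_trans xy.
Qed.

Lemma lg_trunc_log n : (0 < n)%N ->
  (trunc_log 2 n)%:R <= lg (n%:R : R) <= (trunc_log 2 n)%:R + 1.
Proof.
move=> n0; have /andP[tn nt] := trunc_log_bounds (isT : (1 < 2)%N) n0.
set t := trunc_log 2 n in tn nt *.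
have two m : (m%:R : R) = lg (2 ^+ m) by rewrite lgXn ?lg2 ?mulr1.
rewrite natr1 (two t) (two t.+1); apply/andP; split; apply: ler_lg;
  rewrite ?exprn_gt0 ?ltr0n //.
  by rewrite -natrX ler_nat.
by rewrite -natrX ler_nat ltnW.
Qed.

Lemma bc_max_lg n : (0 < n)%N ->
  (n%:R ^+ 2 - n%:R) / 2 <= (bc_max n)%:R * (1 + lg (n%:R : R)).
Proof.
move=> n0; have n0' : (0 : R) < n%:R by rewrite ltr0n.
have -> : 1 + lg (n%:R : R) = lg (2 * n%:R) by rewrite lgM // lg2.
rewrite -lgXn ?mulr_gt0 //.
have -> : ((n%:R ^+ 2 - n%:R) / 2 : R) = lg (2 ^+ 'C(n, 2)).
  rewrite lgXn // lg2 mulr1; have := mul_bin_diag n 1.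
  rewrite bin1 => /(congr1 (fun m => m%:R : R)); rewrite !natrM.
  by case: (n) n0 => // m _ /=; rewrite -natr1; nra.
apply: ler_lg; first by rewrite exprn_gt0.
by rewrite -natrX -natrM -natrX ler_nat bc_max_lower.
Qed.

Lemma bc_max_ge n : (1 < n)%N ->
  (1 / 2 - (trunc_log 2 n)%:R^-1) * (n%:R ^+ 2 / lg n%:R) <= (bc_max n)%:R :> R.
Proof.
move=> n1; have n0 : (0 < n)%N by exact: ltnW.
have /andP[tL _] := lg_trunc_log n0; have W := bc_max_lg n0.
have t1 : 1 <= (trunc_log 2 n)%:R :> R by rewrite ler1n trunc_log_gt0.
have tn : (trunc_log 2 n)%:R <= n%:R :> R.
  rewrite ler_nat; apply: leq_trans (trunc_logP (isT : 1 < 2)%N n0);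
  by rewrite ltnW // ltn_expl.
move: tL W t1 tn; set t := (_ _)%:R; set L := lg _; set x : R := n%:R.
set w : R := (bc_max n)%:R => tL W t1 tn.
rewrite mulrA ler_pdivrMr; last by lra.
rewrite -(ler_pM2r (_ : 0 < 1 + L)); last by lra.
apply: (@le_trans _ _ ((x ^+ 2 - x) / 2 * L)); last by nra.
have ti : t^-1 * t = 1 by rewrite mulVf //; lra.
have ti0 : 0 < t^-1 by rewrite invr_gt0; lra.
set a := t^-1 in ti ti0 *.
(* The quantity 2 (1 / t) lg n absorbs both 1 and (lg n) / n. *)
have aL : 1 <= a * L by nra.
have ax : 1 <= a * x by nra.
suff : x * (x * (1 + L) - 2 * (a * x) * (1 + L)) <= x * (x * L - L) by nra.
rewrite ler_pM2l; last by lra.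
have : L <= (a * x) * L by nra.
nra.
Qed.

Lemma bp_max_real n k : (0 < k)%N ->
  (bp_max n)%:R * (2 * k%:R) <= n%:R ^+ 2 + 4 * k%:R * n%:R * 2 ^+ k :> R.
Proof.
move=> k0; have := bp_max_upper n k0; rewrite -(ler_nat R).
by rewrite !natrD !natrM !natrX.
Qed.

(** The common convergence rate, 1 / sqrt t for t the integer part of lg n. *)
Definition err n : R := (Num.sqrt (trunc_log 2 n)%:R)^-1.

(** The constant 1280 comes from the crude bound with k = 1 when t < 64; for
    larger t the choice k = t - s gives 9. *)
Lemma bp_max_le n : (1 < n)%N ->
  (bp_max n)%:R <= (1 / 2 + 1280 * err n) * (n%:R ^+ 2 / lg n%:R) :> R.
Proof.
move=> n1; have n0 : (0 < n)%N by exact: ltnW.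
have /andP[tL Lt] := lg_trunc_log n0.
have t1 : 1 <= (trunc_log 2 n)%:R :> R by rewrite ler1n trunc_log_gt0.
have tn : (2 ^ trunc_log 2 n <= n)%N by exact: trunc_logP.
have n2 : (2 : R) <= n%:R by rewrite ler_nat.
rewrite mulrA ler_pdivlMr; last by lra.
rewrite /err; set t := trunc_log 2 n in tL Lt t1 tn *.
set L := lg _ in tL Lt *; set x : R := n%:R in n2 *; set w : R := (bp_max n)%:R.
have w0 : 0 <= w by exact: ler0n.
set r := Num.sqrt _; have rt : r ^+ 2 = t%:R by rewrite sqr_sqrtr.
have r1 : 1 <= r by rewrite -sqrtr1 ler_wsqrtr.
have ri : r^-1 * r = 1 by rewrite mulVf //; lra.
have ri0 : 0 < r^-1 by rewrite invr_gt0; lra.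
set a := r^-1 in ri ri0 *.
have [t64|t64] := ltnP t 64.
  (* Here lg n <= 64 and 1 / sqrt t >= 1 / 8, so bp <= 5/2 n^2 is enough. *)
  have := @bp_max_real n 1 isT; rewrite -/x -/w => w1.
  have r8 : r <= 8.
    rewrite -(@ler_pXn2r _ 2) ?nnegrE; [|by []|lra|lra].
    by rewrite rt -natrX ler_nat; lia.
  have a8 : 1 <= 8 * a by nra.
  have L64 : L <= 64.
    by apply: le_trans Lt _; rewrite natr1 ler_nat.
  have wx : w <= 5 / 2 * x ^+ 2 by nra.
  apply: (@le_trans _ _ (w * 64)); first by rewrite ler_wpM2l.
  apply: (@le_trans _ _ (160 * x ^+ 2)); first by lra.
  by rewrite ler_wpM2r ?sqr_ge0 //; lra.
have [k [s [kst s16 kt]]] := block_length t64.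
have r8 : 8 <= r.
  rewrite -(@ler_pXn2r _ 2) ?nnegrE; [|by []|lra|lra].
  by rewrite rt -natrX ler_nat; lia.
have sr : s%:R <= 4 * r.
  rewrite -(@ler_pXn2r _ 2) ?nnegrE; [|by []|exact: ler0n|lra].
  by rewrite exprMn rt -!natrX -natrM ler_nat; lia.
have ktR : k%:R = r ^+ 2 - s%:R by rewrite rt -kst natrD addrK.
have kr : r ^+ 2 - 4 * r <= k%:R by rewrite ktR; lra.
have kr2 : r ^+ 2 / 2 <= k%:R by nra.
have k0 : (0 < k)%N by rewrite -(ltr_nat R); nra.
have Lr : L <= r ^+ 2 + 1 by rewrite rt.
have := bp_max_real n k0; rewrite -/x -/w.
have : 2 ^+ k * (r ^+ 2) ^+ 2 <= x.
  by rewrite rt -!natrX -natrM ler_nat (leq_trans kt).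
have K0 : 0 < (k%:R : R) by rewrite ltr0n.
move: kr kr2 K0; move: (2 ^+ k : R) (k%:R : R) => p K Kr Kr2 K0 px wK.
have wle : w <= x ^+ 2 * ((2 * K)^-1 + 2 * a ^+ 4).
  rewrite -(ler_pM2r (_ : 0 < 2 * K)); last by lra.
  apply: le_trans wK _.
  have -> : x ^+ 2 * ((2 * K)^-1 + 2 * a ^+ 4) * (2 * K) =
      x ^+ 2 * ((2 * K)^-1 * (2 * K) + 4 * K * a ^+ 4) by ring.
  rewrite mulVf; last by rewrite mulf_neq0 // lt0r_neq0.
  have pa : p <= x * a ^+ 4.
    have -> : p = p * (r ^+ 2) ^+ 2 * a ^+ 4.
      by rewrite -mulrA -exprM -exprMn [r * a]mulrC ri expr1n mulr1.
    by rewrite ler_pM2r // exprn_gt0.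
  have : K * x * p <= K * x * (x * a ^+ 4) by rewrite ler_pM2l //; nra.
  lra.
have K1 : (r ^+ 2 + 1) * (2 * K)^-1 <= 1 / 2 + 5 * a.
  rewrite ler_pdivrMr; last by lra.
  have aK : r / 2 <= a * K by nra.
  nra.
have a1 : (r ^+ 2 + 1) * (2 * a ^+ 4) <= 4 * a.
  have -> : (r ^+ 2 + 1) * (2 * a ^+ 4) = 2 * ((a * r) ^+ 2 + a ^+ 2) * a ^+ 2.
    by ring.
  have a1 : a <= 1 by nra.
  have aa : a ^+ 2 <= a by nra.
  rewrite ri expr1n; move: aa; have : 0 <= a ^+ 2 by exact: sqr_ge0.
  move: (a ^+ 2) => c; nra.
have x0 : 0 <= x ^+ 2 by nra.
apply: (@le_trans _ _ (w * (r ^+ 2 + 1))); first by rewrite ler_wpM2l.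
apply: (@le_trans _ _ (x ^+ 2 * ((2 * K)^-1 + 2 * a ^+ 4) * (r ^+ 2 + 1))).
  by rewrite ler_wpM2r //; nra.
rewrite -mulrA [X in _ <= X]mulrC ler_wpM2l //; lra.
Qed.

Lemma err_cvg0 : (err @ \oo --> (0 : R))%classic.
Proof.
apply/cvgr0Pnorm_le => e e0.
have [M eM] : exists M : nat, (e^-1) ^+ 2 <= M%:R.
  exists (Num.bound (e^-1 ^+ 2)); apply/ltW/archi_boundP.
  by rewrite exprn_ge0 // invr_ge0 ltW.
near=> n.
have Mt : (M < trunc_log 2 n)%N.
  apply: trunc_log_max => //.
  by near: n; exact: nbhs_infty_ge.
have rt : e^-1 <= Num.sqrt (trunc_log 2 n)%:R.
  rewrite -(@ler_pXn2r _ 2) ?nnegrE ?sqrtr_ge0 ?invr_ge0 ?(ltW e0) //.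
  by rewrite sqr_sqrtr // (le_trans eM) // ler_nat ltnW.
rewrite /err ger0_norm ?invr_ge0 ?sqrtr_ge0 //.
by rewrite -[leRHS]invrK lef_pV2 ?posrE ?invr_gt0 // (lt_le_trans _ rt) // invr_gt0.
Unshelve. all: end_near. Qed.

Lemma inv_trunc_log_le_err n : (1 < n)%N -> (trunc_log 2 n)%:R^-1 <= err n.
Proof.
move=> n1; have t1 : 1 <= (trunc_log 2 n)%:R :> R by rewrite ler1n trunc_log_gt0.
have t0 : 0 < (trunc_log 2 n)%:R :> R by lra.
rewrite /err lef_pV2 ?posrE ?sqrtr_gt0 //.
rewrite -{2}(sqr_sqrtr (ltW t0)) expr2 ler_peMr ?sqrtr_ge0 //.
by rewrite -{1}sqrtr1 ler_wsqrtr.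
Qed.

End Analysis.

Local Open Scope classical_set_scope.

Theorem mainTheorem1 (R : realType) :
  exists u v : nat -> R,
    [/\ u @ \oo --> (0 : R), v @ \oo --> (0 : R) &
      forall n : nat, (1 < n)%N ->
        [/\ (1 / 2 - u n) * (n%:R ^+ 2 / lg n%:R) <= (bc_max n)%:R,
            ((bc_max n)%:R : R) <= (bp_max n)%:R &
            (bp_max n)%:R <= (1 / 2 + v n) * (n%:R ^+ 2 / lg n%:R)]].
Proof.
exists (@err R), (fun n => 1280 * err R n); split; first exact: err_cvg0.
  by rewrite -[X in _ --> X](mulr0 1280); apply: cvgMr; exact: err_cvg0.
move=> n n1; split.
- apply: le_trans (bc_max_ge R n1); rewrite ler_wpM2r ?lerB //; last first.
    by have := inv_trunc_log_le_err R n1; lra.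
  have /andP[tL _] := lg_trunc_log R (ltnW n1).
  by rewrite divr_ge0 ?exprn_ge0 // (le_trans _ tL).
- by rewrite ler_nat bc_max_le_bp_max.
- exact: bp_max_le.
Qed.
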